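(* Let $\mathcal I\subseteq\mathcal P(\mathbb R^2)$ be a proper, translation-invariant $\sigma$-ideal containing singletons, having a Borel base, and such that every unit circle belongs to $\mathcal I$. Then there exists a completely $\mathcal I$-nonmeasurable set $B\subseteq\mathbb R^2$ which is not a $2$-I-covering.
   Context: A unit circle is $\{y\in\mathbb R^2:\|y-x\|=1\}$ for some $x$. Borel base: every set in $\mathcal I$ is contained in a Borel set in $\mathcal I$. A set $N$ is completely $\mathcal I$-nonmeasurable if for every Borel $A\notin\mathcal I$ both $A\cap N\notin\mathcal I$ and $A\setminus N\notin\mathcal I$. A set $A\subseteq\mathbb R^2$ is a $2$-I-covering if for every $C\subseteq\mathbb R^2$ with $|C|=2$ there is an isometry $\phi$ of the Euclidean plane with $\phi[C]\subseteq A$. *)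

(* Defs.v *)
From Stdlib Require Import Reals.
Open Scope R_scope.

Definition R2 := (R * R)%type.
Definition pset := R2 -> Prop.

Definition dist2 (x y : R2) : R :=
  sqrt ((fst x - fst y)^2 + (snd x - snd y)^2).

Definition subset (A B : pset) : Prop := forall x, A x -> B x.
Definition setT : pset := fun _ => True.
Definition singleton (a : R2) : pset := fun x => x = a.

Definition open_set (U : pset) : Prop :=
  forall x, U x -> exists e, 0 < e /\ forall y, dist2 x y < e -> U y.

Definition sigma_algebra (S : pset -> Prop) : Prop :=
  (forall A, S A -> S (fun x => ~ A x)) /\
  (forall F : nat -> pset, (forall n, S (F n)) -> S (fun x => exists n, F n x)).

Definition borel (A : pset) : Prop :=
  forall S : pset -> Prop, sigma_algebra S ->
    (forall U, open_set U -> S U) -> S A.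

Definition sigma_ideal (I : pset -> Prop) : Prop :=
  I (fun _ => False) /\
  (forall A B, subset A B -> I B -> I A) /\
  (forall F : nat -> pset, (forall n, I (F n)) -> I (fun x => exists n, F n x)).

Definition proper_ideal (I : pset -> Prop) : Prop := ~ I setT.

Definition translate (A : pset) (v : R2) : pset :=
  fun y => A (fst y - fst v, snd y - snd v).

Definition translation_invariant (I : pset -> Prop) : Prop :=
  forall A v, I A -> I (translate A v).

Definition contains_singletons (I : pset -> Prop) : Prop :=
  forall a, I (singleton a).

Definition borel_base (I : pset -> Prop) : Prop :=
  forall A, I A -> exists B, borel B /\ I B /\ subset A B.

Definition unit_circle (c : R2) : pset := fun y => dist2 y c = 1.

Definition completely_nonmeasurable (I : pset -> Prop) (N : pset) : Prop :=
  forall A, borel A -> ~ I A ->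
    ~ I (fun x => A x /\ N x) /\ ~ I (fun x => A x /\ ~ N x).

Definition isometry (phi : R2 -> R2) : Prop :=
  (forall x y, dist2 (phi x) (phi y) = dist2 x y) /\
  (forall y, exists x, phi x = y).

Definition has_card2 (C : pset) : Prop :=
  exists a b, a <> b /\ forall x, C x <-> (x = a \/ x = b).

Definition two_I_covering (A : pset) : Prop :=
  forall C, has_card2 C ->
    exists phi, isometry phi /\ forall x, C x -> A (phi x).

(* Main.v *)
From mathcomp Require ssreflect ssrbool eqtype boolp wochoice.
From Stdlib Require Import Reals Lra Lia Arith List Cantor.
From Stdlib Require Import Classical ClassicalEpsilon FunctionalExtensionality PropExtensionality.
Require Import Defs.
Import ListNotations.
Open Scope R_scope.

(** The set B is built by transfinite recursion so as to contain no two points at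
distance 1 and to meet every Borel set outside I.

Each A not in I of the enumeration must supply a point off all the unit circles centred
at earlier points.  This rests on a perfect set theorem: a Suslin set A not in I contains
a copy of the Cantor set no three points of which lie on a common unit circle.  It is
obtained by fusion on I-positive pieces of A: at most two unit circles pass through two
given points, and they belong to I, so every positive piece has a point off them.  Hence
each circle meets the Cantor set in at most two points, and fewer than continuum many
circles cannot cover it.  Suslin schemes of basic closed sets are coded by elements of
2^N, so 2^N, well-ordered in its least order type, also indexes the recursion.

Meeting all I-positive Borel sets makes every trace of B on them positive, by the Borel
base.  If B contained an I-positive Borel set A, it would also meet A + (1, 0), giving a
unit distance inside B; hence the complement of B has the same property. *)

(** * Well-ordering of an arbitrary type *)

Module WellOrder.
Import ssreflect ssrbool eqtype boolp wochoice.

Lemma exists_well_order (T : Type) :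
  exists lt : T -> T -> Prop, well_founded lt /\
    (forall x y, lt x y \/ x = y \/ lt y x).
Proof.
have [r wo] := well_ordering_principle {classic T}.
have anti : antisymmetric r.
  move=> x y; have wo' : wo_chain r predT by move=> A _; exact: wo.
  exact: (wo_chain_antisymmetric wo').
exists (fun x y => ~ r y x); split.
  move=> x; apply: contrapT => nx.
  (* The [r]-least inaccessible point: everything strictly below it is accessible, hence so is the
     point itself. *)
  have [|z [[/asboolP nz mz] _]] := wo [pred u | `[< ~ Acc (fun x y => ~ r y x) u >]].
    by exists x; apply/asboolP.
  apply: nz; constructor => y; apply: contra_notP => ny.
  by apply: mz; apply/asboolP.
move=> x y; case: (pselect (r y x)) => ryx; last by left.
case: (pselect (r x y)) => rxy; last by right; right.
by right; left; apply: anti; rewrite rxy ryx.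
Qed.
End WellOrder.

(** * Points on a common unit circle *)

Definition sqdist (x y : R2) : R := (fst x - fst y)^2 + (snd x - snd y)^2.
Definition cross (x y z : R2) : R :=
  (fst x - fst z) * (snd y - snd z) - (snd x - snd z) * (fst y - fst z).

(* From the circumradius formula abc = 4 R * area: for distinct points this vanishes iff
   they lie on a common unit circle. *)
Definition circ (x y z : R2) : R :=
  sqdist x y * sqdist y z * sqdist x z - 4 * cross x y z ^ 2.

Lemma circ_swap12 x y z : circ x y z = circ y x z.
Proof. unfold circ, sqdist, cross; ring. Qed.
Lemma circ_swap23 x y z : circ x y z = circ x z y.
Proof. unfold circ, sqdist, cross; ring. Qed.
Lemma dist2_sqdist x y : dist2 x y = sqrt (sqdist x y).
Proof. reflexivity. Qed.

Lemma sqdist_ge0 x y : 0 <= sqdist x y.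
Proof. apply Rplus_le_le_0_compat; apply pow2_ge_0. Qed.

Lemma dist2_eq1 x y : dist2 x y = 1 <-> sqdist x y = 1.
Proof.
rewrite dist2_sqdist; split; intro H.
- rewrite <- (sqrt_sqrt (sqdist x y)) by apply sqdist_ge0. rewrite H; ring.
- rewrite H; apply sqrt_1.
Qed.

Lemma sqdist_eq0 x y : sqdist x y = 0 -> x = y.
Proof.
destruct x as [a b], y as [c d]; unfold sqdist; simpl; intro H.
pose proof (pow2_ge_0 (a - c)); pose proof (pow2_ge_0 (b - d)).
assert (a - c = 0) by (apply Rsqr_0_uniq; unfold Rsqr; lra).
assert (b - d = 0) by (apply Rsqr_0_uniq; unfold Rsqr; lra).
f_equal; lra.
Qed.

Lemma dist2_refl x : dist2 x x = 0.
Proof. rewrite dist2_sqdist; replace (sqdist x x) with 0; [apply sqrt_0|unfold sqdist; ring]. Qed.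

Lemma dist2_sym x y : dist2 x y = dist2 y x.
Proof. rewrite !dist2_sqdist; f_equal; unfold sqdist; ring. Qed.

Lemma dist2_triangle x y z : dist2 x z <= dist2 x y + dist2 y z.
Proof.
pose proof (Rgeom.triangle (fst x) (snd x) (fst z) (snd z) (fst y) (snd y)) as H.
unfold Rgeom.dist_euc in H; rewrite !Rsqr_pow2 in H; exact H.
Qed.

Lemma coord_le_dist2 x y :
  Rabs (fst x - fst y) <= dist2 x y /\ Rabs (snd x - snd y) <= dist2 x y.
Proof.
rewrite dist2_sqdist, <- !sqrt_Rsqr_abs; unfold sqdist, Rsqr.
pose proof (Rle_0_sqr (fst x - fst y)); pose proof (Rle_0_sqr (snd x - snd y)).
unfold Rsqr in *; split; apply sqrt_le_1_alt; lra.
Qed.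

Lemma dist2_le_coord x y :
  dist2 x y <= Rabs (fst x - fst y) + Rabs (snd x - snd y).
Proof.
pose proof (Rabs_pos (fst x - fst y)); pose proof (Rabs_pos (snd x - snd y)).
rewrite dist2_sqdist, <- (sqrt_Rsqr (Rabs (fst x - fst y) + Rabs (snd x - snd y))) by lra.
apply sqrt_le_1_alt; unfold sqdist, Rsqr.
rewrite <- !(pow2_abs (_ - _)); nra.
Qed.

(** With the centre as origin the three points are unit vectors; in terms of their inner products
    [circ] is -4 times their Gram determinant. *)
Lemma circ_unit_circle c x y z :
  unit_circle c x -> unit_circle c y -> unit_circle c z -> circ x y z = 0.
Proof.
unfold unit_circle; rewrite !dist2_eq1.
destruct c as [c1 c2], x as [x1 x2], y as [y1 y2], z as [z1 z2].
unfold circ, sqdist, cross; simpl fst; simpl snd; intros Hx Hy Hz.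
set (a := x1 - c1) in *; set (b := x2 - c2) in *.
set (c := y1 - c1) in *; set (d := y2 - c2) in *.
set (e := z1 - c1) in *; set (f := z2 - c2) in *.
replace (x1 - y1) with (a - c) by (unfold a, c; ring).
replace (x2 - y2) with (b - d) by (unfold b, d; ring).
replace (y1 - z1) with (c - e) by (unfold c, e; ring).
replace (y2 - z2) with (d - f) by (unfold d, f; ring).
replace (x1 - z1) with (a - e) by (unfold a, e; ring).
replace (x2 - z2) with (b - f) by (unfold b, f; ring).
clearbody a b c d e f.
assert (D : forall s t u v : R, s*s+t*t = 1 -> u*u+v*v = 1 ->
  (s - u)^2 + (t - v)^2 = 2 - 2 * (s*u + t*v)).
{ intros s t u v H1 H2; transitivity ((s*s+t*t) + (u*u+v*v) - 2 * (s*u+t*v)); [ring|lra]. }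
assert (Ha : a*a+b*b = 1) by lra; assert (Hc : c*c+d*d = 1) by lra.
assert (He : e*e+f*f = 1) by lra.
(* The Gram determinant of three plane vectors vanishes. *)
assert (G : (a*a+b*b)*(c*c+d*d)*(e*e+f*f) + 2*(a*c+b*d)*(c*e+d*f)*(a*e+b*f)
  - (a*a+b*b)*(c*e+d*f)^2 - (c*c+d*d)*(a*e+b*f)^2 - (e*e+f*f)*(a*c+b*d)^2 = 0) by ring.
(* Lagrange's identity expresses the squared cross product by inner products. *)
assert (L : ((a-e)*(d-f)-(b-f)*(c-e))^2 = ((a-e)^2+(b-f)^2)*((c-e)^2+(d-f)^2)
  - ((a*c+b*d) - (a*e+b*f) - (c*e+d*f) + (e*e+f*f))^2) by ring.
rewrite L, (D a b c d), (D c d e f), (D a b e f) by assumption.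
rewrite Ha, Hc, He in G; rewrite He.
replace (_ - _) with (-4 * 0) by (rewrite <- G; ring); ring.
Qed.

Lemma inv_succ_pos n : 0 < / (INR n + 1).
Proof. apply Rinv_0_lt_compat; pose proof (pos_INR n); lra. Qed.

Lemma inv_succ_lt e : 0 < e -> exists n, / (INR n + 1) < e.
Proof.
intro He; destruct (archimed_cor1 e He) as [[|n] [Hn Hp]]; [lia|].
exists n; rewrite <- S_INR; exact Hn.
Qed.

Lemma inv_succ_le m n : (m <= n)%nat -> / (INR n + 1) <= / (INR m + 1).
Proof.
intro H; apply le_INR in H; pose proof (pos_INR m); apply Rinv_le_contravar; lra.
Qed.

Lemma dist2_Un_cv (u : nat -> R2) (x : R2) : (forall n, dist2 (u n) x < / (INR n + 1)) ->
  Un_cv (fun n => fst (u n)) (fst x) /\ Un_cv (fun n => snd (u n)) (snd x).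
Proof.
intro H; split; intros e He; destruct (inv_succ_lt e He) as [N HN]; exists N; intros n Hn;
  unfold Rdist; destruct (coord_le_dist2 (u n) x); specialize (H n);
  pose proof (inv_succ_le N n Hn); lra.
Qed.

Lemma Un_cv_const c : Un_cv (fun _ => c) c.
Proof. intros e He; exists O; intros n _; rewrite Rdist_eq; exact He. Qed.

(** Sequential continuity: zeros of [circ] within [/ (INR n + 1)] of the three points would force a
    zero in the limit. *)
Lemma circ_near x y z : circ x y z <> 0 ->
  exists e, 0 < e /\ forall x' y' z', dist2 x' x < e -> dist2 y' y < e -> dist2 z' z < e ->
    circ x' y' z' <> 0.
Proof.
intro H; apply NNPP; intro Hn.
assert (Hs : forall n, exists p : R2 * R2 * R2, dist2 (fst (fst p)) x < / (INR n + 1) /\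
  dist2 (snd (fst p)) y < / (INR n + 1) /\ dist2 (snd p) z < / (INR n + 1) /\
  circ (fst (fst p)) (snd (fst p)) (snd p) = 0).
{ intro n; apply NNPP; intro Hp; apply Hn; exists (/ (INR n + 1)).
  split; [apply inv_succ_pos|]; intros x' y' z' Hx Hy Hz H0.
  apply Hp; exists (x', y', z'); auto. }
apply choice in Hs; destruct Hs as [p Hp].
destruct (dist2_Un_cv (fun n => fst (fst (p n))) x) as [X1 X2]; [apply Hp|].
destruct (dist2_Un_cv (fun n => snd (fst (p n))) y) as [Y1 Y2]; [apply Hp|].
destruct (dist2_Un_cv (fun n => snd (p n)) z) as [Z1 Z2]; [apply Hp|].
apply H, (UL_sequence (fun n => circ (fst (fst (p n))) (snd (fst (p n))) (snd (p n)))).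
- unfold circ, sqdist, cross; simpl pow.
  repeat match goal with
  | |- Un_cv (fun n => _ * _) _ => apply CV_mult
  | |- Un_cv (fun n => _ - _) _ => apply CV_minus
  | |- Un_cv (fun n => _ + _) _ => apply CV_plus
  end; assumption || apply Un_cv_const.
- intros e He; exists O; intros n _; destruct (Hp n) as (_ & _ & _ & ->).
  rewrite Rdist_eq; exact He.
Qed.

Lemma sigma_ideal_union2 I A B : sigma_ideal I -> I A -> I B -> I (fun x => A x \/ B x).
Proof.
intros (_ & Hs & Hu) HA HB.
apply (Hs _ (fun x => exists n : nat, (match n with O => A | _ => B end) x)).
- intros x [Hx|Hx]; [exists O|exists 1%nat]; exact Hx.
- apply Hu; intros [|n]; assumption.
Qed.

Lemma circ_zero_covered x y : x <> y -> exists c d, forall z, circ x y z = 0 ->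
  z = x \/ z = y \/ unit_circle c z \/ unit_circle d z.
Proof.
intro Hxy.
assert (HL : 0 < sqdist x y).
{ destruct (Rle_lt_or_eq_dec _ _ (sqdist_ge0 x y)) as [h|h]; [exact h|].
  destruct (Hxy (sqdist_eq0 _ _ (eq_sym h))). }
(* The two unit circles through x and y are centred on their perpendicular bisector. *)
pose (h := sqrt ((1 - sqdist x y / 4) / sqdist x y)).
pose (c := fun s : R => ((fst x + fst y) / 2 + s * h * (snd x - snd y),
                (snd x + snd y) / 2 - s * h * (fst x - fst y)) : R2).
exists (c 1), (c (-1)); intros z Hz.
pose (M := (fst x - fst z) * (fst y - fst z) + (snd x - snd z) * (snd y - snd z)).
pose (N := cross x y z).
assert (HMN : sqdist x z * sqdist y z = M^2 + N^2)
  by (unfold sqdist, M, N, cross; ring).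
assert (HG : sqdist x y * M^2 = (4 - sqdist x y) * N^2).
{ unfold circ in Hz; fold N in Hz.
  replace (sqdist x y * M^2) with (sqdist x y * (M^2 + N^2) - sqdist x y * N^2) by ring.
  rewrite <- HMN; lra. }
(* If [x] and [y] are at distance at most 2, [HG] factors as [M = 2 * h * N] or [M = - 2 * h * N],
   one case for each circle. Otherwise its sides have opposite signs, so [M] and [N] vanish and [z]
   is [x] or [y]. *)
destruct (Rle_lt_dec (sqdist x y) 4) as [H4|H4].
- assert (Hh : h * h = (1 - sqdist x y / 4) / sqdist x y).
  { apply sqrt_sqrt; apply Rmult_le_pos; [lra|]; left; apply Rinv_0_lt_compat; exact HL. }
  assert (Hd : forall s, s * s = 1 -> sqdist z (c s) = 1 + M - 2 * s * h * N).
  { intros s Hs.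
    transitivity (M + sqdist x y / 4 - 2 * s * h * N + (s * s) * (h * h) * sqdist x y).
    - unfold sqdist, M, N, cross, c; simpl fst; simpl snd; field.
    - rewrite Hs, Hh; field; lra. }
  assert (Hp : (M + 2 * h * N) * (M - 2 * h * N) = 0).
  { replace (_ * _) with (M^2 - 4 * (h * h) * N^2) by ring; rewrite Hh.
    apply (Rmult_eq_reg_l (sqdist x y)); [|lra].
    replace (sqdist x y * (M^2 - 4 * ((1 - sqdist x y / 4) / sqdist x y) * N^2)) with
      (sqdist x y * M^2 - (4 - sqdist x y) * N^2) by (field; lra).
    lra. }
  right; right; unfold unit_circle; rewrite !dist2_eq1, !Hd by ring.
  destruct (Rmult_integral _ _ Hp); [right|left]; lra.
- assert (H0 : sqdist x z * sqdist y z = 0).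
  { rewrite HMN; pose proof (pow2_ge_0 M); pose proof (pow2_ge_0 N); nra. }
  destruct (Rmult_integral _ _ H0) as [h0|h0]; apply sqdist_eq0 in h0; auto.
Qed.

(** The guard [x <> y] matters: [circ x x z] vanishes for every [z]. *)
Definition bad (x y z : R2) : Prop := z = x \/ (x <> y /\ circ x y z = 0).

Lemma bad_in_ideal I x y : sigma_ideal I -> contains_singletons I ->
  (forall c, I (unit_circle c)) -> I (bad x y).
Proof.
intros HI Hs Hc; pose proof HI as (_ & Hsub & _).
destruct (classic (x = y)) as [<-|Hxy].
- apply (Hsub _ (singleton x)); [|apply Hs]; intros z [Hz|[[] _]]; auto.
- destruct (circ_zero_covered x y Hxy) as (c & d & H).
  apply (Hsub _ (fun z => singleton x z \/ (singleton y z \/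
    (unit_circle c z \/ unit_circle d z)))).
  + intros z [->|[_ Hz]]; [left; reflexivity|].
    destruct (H z Hz) as [->|[->|[h|h]]]; unfold singleton; auto.
  + repeat apply sigma_ideal_union2; auto.
Qed.

(** * Suslin sets and their codes *)

(** An enumeration of the rational points: [m] codes a common denominator and two numerators, each a
    difference of naturals to allow for signs. *)
Definition gridpt (m : nat) : R2 :=
  let (n, r) := of_nat m in
  let (ab, cd) := of_nat r in
  let (a, b) := of_nat ab in
  let (c, d) := of_nat cd in
  ((INR a - INR b) * / (INR n + 1), (INR c - INR d) * / (INR n + 1)).

Lemma grid_approx (r : R) (n : nat) :
  exists a b, Rabs (r - (INR a - INR b) * / (INR n + 1)) <= / (INR n + 1).
Proof.
pose proof (pos_INR n) as Hn; pose proof (inv_succ_pos n) as Hi.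
destruct (archimed (r * (INR n + 1))) as [H1 H2].
set (z := up (r * (INR n + 1))) in *.
exists (Z.to_nat z), (Z.to_nat (- z)).
assert (Hz : INR (Z.to_nat z) - INR (Z.to_nat (- z)) = IZR z).
{ rewrite !INR_IZR_INZ, <- minus_IZR; f_equal; lia. }
rewrite Hz.
replace (r - IZR z * / (INR n + 1)) with (- ((IZR z - r * (INR n + 1)) * / (INR n + 1)))
  by (field; lra).
rewrite Rabs_Ropp, Rabs_pos_eq; nra.
Qed.

Lemma gridpt_dense x e : 0 < e -> exists m, dist2 x (gridpt m) < e.
Proof.
intro He; destruct (inv_succ_lt (e / 2)) as [n Hn]; [lra|].
destruct (grid_approx (fst x) n) as (a & b & Hab).
destruct (grid_approx (snd x) n) as (c & d & Hcd).
exists (to_nat (n, to_nat (to_nat (a, b), to_nat (c, d)))).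
unfold gridpt; rewrite !cancel_of_to.
eapply Rle_lt_trans; [apply dist2_le_coord|]; cbn [fst snd]; lra.
Qed.

Definition gball (m k : nat) : pset := fun x => dist2 x (gridpt m) < / (INR k + 1).

Lemma gball_basis (U : pset) x e : 0 < e -> (forall y, dist2 x y < e -> U y) ->
  exists m k, gball m k x /\ subset (gball m k) U.
Proof.
intros He HU; destruct (inv_succ_lt (e / 2)) as [k Hk]; [lra|].
destruct (gridpt_dense x (/ (INR k + 1)) (inv_succ_pos k)) as [m Hm].
exists m, k; split; [exact Hm|]; intros y Hy; apply HU.
pose proof (dist2_triangle x (gridpt m) y) as Ht.
unfold gball in Hy; rewrite dist2_sym in Hy; lra.
Qed.

Definition closed_set (C : pset) : Prop := open_set (fun x => ~ C x).

Definition pre (y : nat -> nat) (n : nat) : list nat := map y (seq 0 n).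

Lemma pre_succ y n : pre y (S n) = pre y n ++ [y n].
Proof. unfold pre; rewrite seq_S, map_app; reflexivity. Qed.

Lemma pre_succ_l y n : pre y (S n) = y 0%nat :: pre (fun k => y (S k)) n.
Proof. unfold pre; cbn; rewrite <- seq_shift, map_map; reflexivity. Qed.

Lemma pre_length y n : length (pre y n) = n.
Proof. unfold pre; rewrite length_map, length_seq; reflexivity. Qed.

Lemma nth_pre y n k : (k < n)%nat -> nth k (pre y n) 0%nat = y k.
Proof.
intro Hk; unfold pre; rewrite nth_indep with (d' := y 0%nat)
  by (rewrite length_map, length_seq; exact Hk).
rewrite map_nth, seq_nth; [reflexivity|exact Hk].
Qed.

(** The Suslin operation applied to the scheme [C]. *)
Definition suslin (C : list nat -> pset) : pset := fun x => exists y, forall n, C (pre y n) x.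

Definition analytic (A : pset) : Prop :=
  exists C, (forall s, closed_set (C s)) /\ forall x, A x <-> suslin C x.

Lemma analytic_ext (A B : pset) : (forall x, A x <-> B x) -> analytic A -> analytic B.
Proof.
intros H (C & HC & HA); exists C; split; [exact HC|]; intro x; rewrite <- H; apply HA.
Qed.

Lemma analytic_union (A : nat -> pset) :
  (forall i, analytic (A i)) -> analytic (fun x => exists i, A i x).
Proof.
intro H; apply choice in H; destruct H as [C HC].
(* The first entry of a branch chooses the set, the rest is a branch through its scheme. *)
exists (fun s => match s with [] => setT | i :: s' => C i s' end); split.
- intros [|i s]; [intros x Hx; destruct (Hx Logic.I)|apply (HC i)].
- intro x; split.
  + intros [i Hi]; apply (HC i) in Hi; destruct Hi as [y Hy].
    exists (fun n => match n with O => i | S k => y k end).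
    intros [|n]; [exact Logic.I|]; rewrite pre_succ_l; apply Hy.
  + intros [y Hy]; exists (y 0%nat); apply HC; exists (fun k => y (S k)).
    intro n; specialize (Hy (S n)); rewrite pre_succ_l in Hy; exact Hy.
Qed.

Lemma analytic_inter (A : nat -> pset) :
  (forall i, analytic (A i)) -> analytic (fun x => forall i, A i x).
Proof.
intro H; apply choice in H; destruct H as [C HC].
(* A branch through the new scheme interleaves one branch through each [C i]. *)
exists (fun s x => forall i n, (forall k, (k < n)%nat -> (to_nat (i, k) < length s)%nat) ->
  C i (map (fun k => nth (to_nat (i, k)) s 0%nat) (seq 0 n)) x); split.
- intros s x Hx; apply not_all_ex_not in Hx; destruct Hx as [i Hx].
  apply not_all_ex_not in Hx; destruct Hx as [n Hx].
  apply imply_to_and in Hx; destruct Hx as [Hn Hx].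
  destruct (proj1 (HC i) _ x Hx) as (e & He & Hy); exists e; split; [exact He|].
  intros y Hxy Hall; apply (Hy y Hxy), Hall, Hn.
- intro x; split.
  + intro Hx; assert (Hy : forall i, exists y, forall n, C i (pre y n) x)
      by (intro i; apply HC, Hx).
    apply choice in Hy; destruct Hy as [y Hy].
    exists (fun m => let (i, k) := of_nat m in y i k); intros N i n Hn.
    rewrite pre_length in Hn.
    replace (map _ (seq 0 n)) with (pre (y i) n); [apply Hy|].
    apply map_ext_in; intros k Hk; apply in_seq in Hk.
    rewrite nth_pre by (apply Hn; lia); rewrite cancel_of_to; reflexivity.
  + intros [y Hy] i; apply HC; exists (fun k => y (to_nat (i, k))); intro n.
    (* A prefix of length [N] contains the first [n] entries of the branch through [C i]. *)
    assert (HN : exists N, forall k, (k < n)%nat -> (to_nat (i, k) < N)%nat).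
    { induction n as [|n [N IH]]; [exists O; lia|].
      exists (Nat.max N (S (to_nat (i, n)))); intros k Hk.
      destruct (Nat.eq_dec k n) as [->|]; [lia|]; specialize (IH k ltac:(lia)); lia. }
    destruct HN as [N HN]; specialize (Hy N i n).
    rewrite pre_length in Hy; specialize (Hy HN).
    replace (pre _ n) with (map (fun k => nth (to_nat (i, k)) (pre y N) 0%nat) (seq 0 n));
      [exact Hy|].
    apply map_ext_in; intros k Hk; apply in_seq in Hk; apply nth_pre, HN; lia.
Qed.

Lemma analytic_closed C : closed_set C -> analytic C.
Proof.
intro HC; exists (fun _ => C); split; [auto|]; intro x; split.
- intro Hx; exists (fun _ => O); auto.
- intros [_ Hx]; exact (Hx O).
Qed.

(** An open set is the countable union, over [n], of the closed sets of points whose ball of radius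
    [/ (INR n + 1)] stays inside it. *)
Lemma analytic_open U : open_set U -> analytic U.
Proof.
intro HU.
apply (analytic_ext (fun x => exists n, forall y, dist2 x y < / (INR n + 1) -> U y)).
- intro x; split.
  + intros [n Hn]; apply Hn; rewrite dist2_refl; apply inv_succ_pos.
  + intro Hx; destruct (HU x Hx) as (e & He & Hy).
    destruct (inv_succ_lt e He) as [n Hn]; exists n; intros y Hxy; apply Hy; lra.
- apply analytic_union; intro n; apply analytic_closed; intros x Hx.
  apply not_all_ex_not in Hx; destruct Hx as [y Hx]; apply imply_to_and in Hx.
  destruct Hx as [Hxy Hy]; exists (/ (INR n + 1) - dist2 x y); split; [lra|].
  intros z Hz Hall; apply Hy, Hall.
  pose proof (dist2_triangle z x y) as Ht; rewrite (dist2_sym z x) in Ht; lra.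
Qed.

(** Analytic sets are not closed under complement, but those with analytic complement form a
    sigma-algebra containing the open sets. *)
Lemma borel_analytic A : borel A -> analytic A.
Proof.
intro HA.
cut (analytic A /\ analytic (fun x => ~ A x)); [tauto|].
apply (HA (fun A => analytic A /\ analytic (fun x => ~ A x))).
- split.
  + intros B [H1 H2]; split; [exact H2|].
    apply (analytic_ext B); [intro x; split; [auto|apply NNPP]|exact H1].
  + intros F HF; split.
    * apply analytic_union; intro n; apply HF.
    * apply (analytic_ext (fun x => forall n, ~ F n x)).
      -- intro x; split; [intros H [n Hn]; exact (H n Hn)|intros H n Hn; apply H; eauto].
      -- apply analytic_inter; intro n; apply HF.
- intros U HU; split; [apply analytic_open, HU|].
  apply analytic_closed; intros x Hx; apply NNPP in Hx.
  destruct (HU x Hx) as (e & He & Hy); exists e; split; [exact He|].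
  intros y Hxy H; exact (H (Hy y Hxy)).
Qed.

Fixpoint encode (l : list nat) : nat :=
  match l with [] => O | a :: l' => S (to_nat (a, encode l')) end.

Lemma encode_inj l l' : encode l = encode l' -> l = l'.
Proof.
revert l'; induction l as [|a l IH]; intros [|b l']; cbn [encode]; try discriminate; auto.
intro H; apply eq_add_S, (f_equal of_nat) in H; rewrite !cancel_of_to in H.
injection H as -> H; f_equal; auto.
Qed.

(** The bits of [t] say which basic balls to remove at each [s]; what is left is closed, so every
    [t] codes an analytic set. *)
Definition decode (t : nat -> bool) : pset :=
  suslin (fun s x => forall m k, t (to_nat (encode s, to_nat (m, k))) = true -> ~ gball m k x).

(** A closed set is the complement of the basic balls that miss it; the code marks exactly these
    balls. *)
Lemma analytic_decode A : analytic A -> exists t, forall x, A x <-> decode t x.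
Proof.
intros (C & HC & HA).
pose (P := fun j => exists s m k, j = to_nat (encode s, to_nat (m, k)) /\
  forall x, gball m k x -> ~ C s x).
exists (fun j => if excluded_middle_informative (P j) then true else false).
assert (E : forall s x, C s x <-> forall m k,
  (if excluded_middle_informative (P (to_nat (encode s, to_nat (m, k)))) then true else false)
    = true -> ~ gball m k x).
{ intros s x; split.
  - intros Hx m k; destruct (excluded_middle_informative _) as [Hp|]; [|discriminate].
    intros _ Hb; destruct Hp as (s' & m' & k' & Hj & Hd).
    apply (f_equal of_nat) in Hj; rewrite !cancel_of_to in Hj.
    apply pair_equal_spec in Hj; destruct Hj as [Hs Hmk].
    apply (f_equal of_nat) in Hmk; rewrite !cancel_of_to in Hmk.
    injection Hmk as <- <-; apply encode_inj in Hs; subst s'; exact (Hd x Hb Hx).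
  - intros H; apply NNPP; intro Hx; destruct (HC s x Hx) as (e & He & Hy).
    destruct (gball_basis (fun y => ~ C s y) x e He Hy) as (m & k & Hb & Hs).
    apply (H m k); [|exact Hb].
    destruct (excluded_middle_informative _) as [|Hn]; [reflexivity|].
    destruct Hn; exists s, m, k; split; [reflexivity|exact Hs]. }
intro x; rewrite HA; split; intros [y Hy]; exists y; intro n; apply E, Hy.
Qed.

Lemma decode_analytic t : analytic (decode t).
Proof.
unfold decode; eexists; split; [|intro x; reflexivity].
intros s x Hx; apply not_all_ex_not in Hx; destruct Hx as [m Hx].
apply not_all_ex_not in Hx; destruct Hx as [k Hx]; apply imply_to_and in Hx.
destruct Hx as [Ht Hb]; apply NNPP in Hb; unfold gball in Hb.
exists (/ (INR k + 1) - dist2 x (gridpt m)); split; [lra|].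
intros y Hy Hall; apply (Hall m k Ht); unfold gball.
pose proof (dist2_triangle y x (gridpt m)) as H; rewrite (dist2_sym y x) in H; lra.
Qed.

(** * Fusion *)

Definition distinct3 {T : Type} (i j k : T) : Prop := i <> j /\ j <> k /\ i <> k.

(** Around these points [E] can be cut down to any small diameter and still stay outside [I]. *)
Definition supp (I : pset -> Prop) (E : pset) : pset :=
  fun x => E x /\ forall e, 0 < e -> ~ I (fun y => E y /\ dist2 y x < e).

Lemma sigma_ideal_sub I A B : sigma_ideal I -> subset A B -> I B -> I A.
Proof. intros (_ & H & _); apply H. Qed.

(** Each exceptional point lies in a basic ball whose trace on [E] is in [I], and there are
    countably many basic balls. *)
Lemma supp_full I E : sigma_ideal I -> I (fun x => E x /\ ~ supp I E x).
Proof.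
intro HI; pose proof HI as (H0 & Hsub & Hu).
pose (F := fun m k : nat => fun x => E x /\ gball m k x /\ I (fun y => E y /\ gball m k y)).
assert (HF : forall m k, I (F m k)).
{ intros m k; destruct (classic (I (fun y => E y /\ gball m k y))) as [h|h].
  - apply (Hsub _ _) with (2 := h); intros x (a & b & _); auto.
  - apply (Hsub _ _) with (2 := H0); intros x (_ & _ & c); exact (h c). }
apply (Hsub _ (fun x => exists m k, F m k x)); [|apply Hu; intro m; apply Hu, HF].
intros x [Hx Hn].
assert (He : exists e, 0 < e /\ I (fun y => E y /\ dist2 y x < e)).
{ apply NNPP; intro h; apply Hn; split; [exact Hx|]; intros e He Hi; apply h; eauto. }
destruct He as (e & He & Hi).
destruct (gball_basis (fun y => dist2 y x < e) x e He) as (m & k & Hb & Hs).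
{ intros y Hy; rewrite dist2_sym; exact Hy. }
exists m, k; split; [exact Hx|split; [exact Hb|]].
apply (Hsub _ _) with (2 := Hi); intros y [Hy Hyb]; split; [exact Hy|exact (Hs y Hyb)].
Qed.

Lemma generic_points I (E : nat -> pset) (n : nat) :
  sigma_ideal I -> contains_singletons I -> (forall c, I (unit_circle c)) ->
  (forall i, (i < n)%nat -> ~ I (E i)) ->
  exists x : nat -> R2, (forall i, (i < n)%nat -> supp I (E i) (x i)) /\
    forall i j k, (i < n)%nat -> (j < n)%nat -> (k < n)%nat -> distinct3 i j k ->
      circ (x i) (x j) (x k) <> 0.
Proof.
intros HI Hs Hc HE; pose proof HI as (_ & Hsub & Hu).
(* Distinctness joins the induction because [bad] controls [circ] only over distinct pairs. *)
cut (exists x : nat -> R2, (forall i, (i < n)%nat -> supp I (E i) (x i)) /\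
  (forall i j, (i < n)%nat -> (j < n)%nat -> i <> j -> x i <> x j) /\
    forall i j k, (i < n)%nat -> (j < n)%nat -> (k < n)%nat -> distinct3 i j k ->
      circ (x i) (x j) (x k) <> 0).
{ intros (x & H1 & _ & H2); exists x; auto. }
induction n as [|n IH].
{ exists (fun _ => (0, 0)); repeat split; intros; lia. }
destruct IH as (x & Hx & Hd & Hg); [intros i Hi; apply HE; lia|].
(* All [i] and [j] may be avoided at once, since countably many sets in [I] do not cover [E n]. *)
assert (Hp : exists p, supp I (E n) p /\ forall i j, ~ bad (x i) (x j) p).
{ apply NNPP; intro Hn; apply (HE n (Nat.lt_succ_diag_r n)).
  apply (Hsub _ (fun p => (E n p /\ ~ supp I (E n) p) \/ exists i j, bad (x i) (x j) p)).
  - intros p Hp; destruct (classic (supp I (E n) p)) as [h|h]; [right|left; auto].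
    apply NNPP; intro Hb; apply Hn; exists p; split; [exact h|].
    intros i j Hij; apply Hb; eauto.
  - apply sigma_ideal_union2; [exact HI|apply supp_full, HI|].
    apply Hu; intro i; apply Hu; intro j; apply bad_in_ideal; assumption. }
destruct Hp as (p & Hp & Hb).
assert (Hbx : forall i, x i <> p) by (intros i h; apply (Hb i i); left; auto).
assert (Hbc : forall i j, (i < n)%nat -> (j < n)%nat -> i <> j -> circ (x i) (x j) p <> 0)
  by (intros i j Hi Hj Hij h; apply (Hb i j); right; auto).
exists (fun i => if Nat.eq_dec i n then p else x i); split; [|split].
- intros i Hi; destruct (Nat.eq_dec i n) as [->|]; [exact Hp|apply Hx; lia].
- intros i j Hi Hj Hij; destruct (Nat.eq_dec i n), (Nat.eq_dec j n); try lia; auto.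
  apply Hd; lia.
- intros i j k Hi Hj Hk (Hij & Hjk & Hik).
  destruct (Nat.eq_dec i n), (Nat.eq_dec j n), (Nat.eq_dec k n); try lia.
  + rewrite circ_swap12, circ_swap23; apply Hbc; lia.
  + rewrite circ_swap23; apply Hbc; lia.
  + apply Hbc; lia.
  + apply Hg; unfold distinct3; lia.
Qed.

Lemma finite_min_eps (n : nat) (P : nat -> R -> Prop) :
  (forall i a b, b <= a -> P i a -> P i b) ->
  (forall i, (i < n)%nat -> exists e, 0 < e /\ P i e) ->
  exists e, 0 < e /\ forall i, (i < n)%nat -> P i e.
Proof.
intro Hm; induction n as [|n IH]; intro H; [exists 1; split; [lra|intros; lia]|].
destruct IH as (e & He & HP); [intros i Hi; apply H; lia|].
destruct (H n (Nat.lt_succ_diag_r n)) as (d & Hd & HPd).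
pose proof (Rmin_l e d); pose proof (Rmin_r e d).
exists (Rmin e d); split; [apply Rmin_glb_lt; assumption|].
intros i Hi; destruct (Nat.eq_dec i n) as [->|]; [eapply Hm; eauto|].
eapply Hm; [|apply HP; lia]; assumption.
Qed.

Lemma circ_near_finite (x : nat -> R2) (n : nat) :
  (forall i j k, (i < n)%nat -> (j < n)%nat -> (k < n)%nat -> distinct3 i j k ->
      circ (x i) (x j) (x k) <> 0) ->
  exists e, 0 < e /\ forall i j k, (i < n)%nat -> (j < n)%nat -> (k < n)%nat ->
    distinct3 i j k -> forall p q r, dist2 p (x i) < e -> dist2 q (x j) < e ->
    dist2 r (x k) < e -> circ p q r <> 0.
Proof.
intro H.
destruct (finite_min_eps n (fun i e => forall j, (j < n)%nat -> forall k, (k < n)%nat ->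
  distinct3 i j k -> forall p q r, dist2 p (x i) < e -> dist2 q (x j) < e ->
    dist2 r (x k) < e -> circ p q r <> 0)) as (e & He & HP); 
  [| |exists e; split; [exact He|]; intros i j k Hi Hj Hk; exact (HP i Hi j Hj k Hk)].
{ intros i a b Hab HP j Hj k Hk Hd p q r Hp Hq Hr; apply (HP j Hj k Hk Hd); lra. }
intros i Hi; apply finite_min_eps.
{ intros j a b Hab HP k Hk Hd p q r Hp Hq Hr; apply (HP k Hk Hd); lra. }
intros j Hj; apply finite_min_eps.
{ intros k a b Hab HP Hd p q r Hp Hq Hr; apply (HP Hd); lra. }
intros k Hk; destruct (classic (distinct3 i j k)) as [Hd|Hd].
- destruct (circ_near _ _ _ (H i j k Hi Hj Hk Hd)) as (e & He & HP); exists e; auto.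
- exists 1; split; [lra|]; intro h; destruct (Hd h).
Qed.

Definition branches (C : list nat -> pset) (s : list nat) : pset :=
  fun x => exists y, pre y (length s) = s /\ forall n, C (pre y n) x.

Lemma branches_succ C s x : branches C s x -> exists a, branches C (s ++ [a]) x.
Proof.
intros (y & Hy & HC); exists (y (length s)), y; split; [|exact HC].
rewrite length_app; cbn [length]; rewrite Nat.add_1_r, pre_succ, Hy; reflexivity.
Qed.

Definition node : Type := (list nat * pset)%type.

Definition positive_node (I : pset -> Prop) (C : list nat -> pset) (d : node) : Prop :=
  ~ I (snd d) /\ subset (snd d) (branches C (fst d)).

(** Along a path of refinements the appended entries form a branch of the scheme, and nesting with
    shrinking diameters gives a limit point. *)
Definition refines (eta : R) (d d' : node) : Prop :=
  (exists a, fst d' = fst d ++ [a]) /\ subset (snd d') (snd d) /\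
  forall p q, snd d' p -> snd d' q -> dist2 p q < eta.

(** The margin [e] is there for the limit points of the fusion, which are near the pieces but need
    not lie in them. *)
Definition separated (n : nat) (d : nat -> node) : Prop :=
  exists e, 0 < e /\ forall i j k, (i < n)%nat -> (j < n)%nat -> (k < n)%nat ->
    distinct3 i j k -> forall p q r p' q' r',
    snd (d i) p' -> snd (d j) q' -> snd (d k) r' ->
    dist2 p p' < e -> dist2 q q' < e -> dist2 r r' < e -> circ p q r <> 0.

(** Cut each piece down to a small ball around a generic point. The result is positive and is the
    countable union of its parts along the one-entry extensions, so one part is positive. *)
Lemma fusion_step I C (d : nat -> node) (n : nat) (eta : R) :
  sigma_ideal I -> contains_singletons I -> (forall c, I (unit_circle c)) -> 0 < eta ->
  (forall i, (i < n)%nat -> positive_node I C (d i)) ->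
  exists d', separated n d' /\
    forall i, (i < n)%nat -> positive_node I C (d' i) /\ refines eta (d i) (d' i).
Proof.
intros HI Hs Hc Heta Hd; pose proof HI as (_ & Hsub & Hu).
destruct (generic_points I (fun i => snd (d i)) n HI Hs Hc) as (x & Hx & Hg);
  [intros i Hi; apply Hd, Hi|].
destruct (circ_near_finite x n Hg) as (e & He & Hsep).
(* A point within [r] of the new piece is within [e] of [x i], and the new piece has diameter below
   [eta]. *)
pose (r := Rmin (e / 2) (eta / 2)).
assert (Hr : 0 < r) by (apply Rmin_glb_lt; lra).
assert (Hr1 : r <= e / 2) by apply Rmin_l.
assert (Hr2 : r <= eta / 2) by apply Rmin_r.
assert (H : forall i, exists d' : node, (i < n)%nat -> positive_node I C d' /\
  refines eta (d i) d' /\ forall p, snd d' p -> dist2 p (x i) < r).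
{ intro i; destruct (classic (i < n)%nat) as [Hi|Hi]; [|exists (d i); tauto].
  apply NNPP; intro Hn.
  apply (proj2 (Hx i Hi) r Hr).
  apply (Hsub _ (fun p => exists a, (snd (d i) p /\ dist2 p (x i) < r) /\
    branches C (fst (d i) ++ [a]) p)).
  - intros p [Hp Hpx]; destruct (branches_succ C _ p (proj2 (Hd i Hi) p Hp)) as [a Ha].
    exists a; auto.
  - apply Hu; intro a; apply NNPP; intro Ha; apply Hn.
    exists (fst (d i) ++ [a], fun p => (snd (d i) p /\ dist2 p (x i) < r) /\
      branches C (fst (d i) ++ [a]) p); intros _; split; [|split; [split|]]; cbn [fst snd].
    + split; [exact Ha|]; intros p [_ Hp]; exact Hp.
    + exists a; reflexivity.
    + split; [intros p [[Hp _] _]; exact Hp|].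
      intros p q [[_ Hp] _] [[_ Hq] _]; pose proof (dist2_triangle p (x i) q) as Ht.
      rewrite (dist2_sym (x i) q) in Ht; lra.
    + intros p [[_ Hp] _]; exact Hp. }
apply choice in H; destruct H as [d' Hd'].
exists d'; split; [|intros i Hi; destruct (Hd' i Hi) as (h1 & h2 & _); auto].
exists r; split; [exact Hr|]; intros i j k Hi Hj Hk Hijk p q s p' q' s' Hp' Hq' Hs' Hp Hq Hs0.
apply (proj2 (proj2 (Hd' i Hi))) in Hp'; apply (proj2 (proj2 (Hd' j Hj))) in Hq'.
apply (proj2 (proj2 (Hd' k Hk))) in Hs'.
pose proof (dist2_triangle p p' (x i)); pose proof (dist2_triangle q q' (x j)).
pose proof (dist2_triangle s s' (x k)).
apply (Hsep i j k Hi Hj Hk Hijk); lra.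
Qed.

(** * The binary tree of pieces and its limit points *)

Lemma dependent_choice (X : Type) (P : nat -> X -> Prop) (Q : nat -> X -> X -> Prop) :
  (exists x, P O x) -> (forall n x, P n x -> exists y, P (S n) y /\ Q n x y) ->
  exists f : nat -> X, forall n, P n (f n) /\ Q n (f n) (f (S n)).
Proof.
intros [x0 H0] Hs.
assert (H : forall a : nat * X, exists y,
  P (fst a) (snd a) -> P (S (fst a)) y /\ Q (fst a) (snd a) y).
{ intros [n x]; destruct (classic (P n x)) as [h|h]; [|exists x; intro h'; destruct (h h')].
  destruct (Hs n x h) as [y Hy]; exists y; auto. }
apply choice in H; destruct H as [g Hg].
pose (f := nat_rect (fun _ => X) x0 (fun n x => g (n, x))).
assert (Hf : forall n, P n (f n)).
{ induction n as [|n IH]; [exact H0|apply (Hg (n, f n)), IH]. }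
exists f; intro n; split; [apply Hf|apply (Hg (n, f n)), Hf].
Qed.

(* The nodes of level [n] of the binary tree are numbered below [2 ^ n];
   the parent of node [j] is [Nat.div2 j]. *)
Fixpoint branch_index (z : nat -> bool) (n : nat) : nat :=
  match n with O => O | S m => (2 * branch_index z m + Nat.b2n (z m))%nat end.

Lemma branch_index_lt z n : (branch_index z n < 2 ^ n)%nat.
Proof.
induction n as [|n IH]; cbn [branch_index]; [cbn; lia|].
rewrite Nat.pow_succ_r'; destruct (z n); cbn [Nat.b2n]; lia.
Qed.

Lemma branch_index_div2 z n : Nat.div2 (branch_index z (S n)) = branch_index z n.
Proof.
cbn [branch_index]; destruct (z n); cbn [Nat.b2n].
- rewrite Nat.add_1_r; apply Nat.div2_succ_double.
- rewrite Nat.add_0_r; apply Nat.div2_double.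
Qed.

(** A differing bit [m] gives indices of different parity or different parents at level [S m];
    halving carries any later equality back to that level. *)
Lemma branch_index_neq z z' : z <> z' ->
  exists N, forall n, (N <= n)%nat -> branch_index z n <> branch_index z' n.
Proof.
intro H; assert (Hm : exists m, z m <> z' m).
{ apply NNPP; intro h; apply H; apply functional_extensionality.
  intro m; apply NNPP; intro hm; apply h; eauto. }
destruct Hm as [m Hm]; exists (S m); intros n Hn; induction Hn as [|n Hn IH].
- cbn [branch_index]; intro E; apply Hm; destruct (z m), (z' m); cbn [Nat.b2n] in E;
    lia || reflexivity.
- intro E; apply IH.
  rewrite <- (branch_index_div2 z n), <- (branch_index_div2 z' n), E; reflexivity.
Qed.

Lemma R2_limit (p : nat -> R2) : (forall m n, (m <= n)%nat -> dist2 (p m) (p n) <= / (INR m + 1)) ->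
  exists x, forall e, 0 < e -> exists N, forall n, (N <= n)%nat -> dist2 x (p n) < e.
Proof.
intro H.
assert (Hc : forall c : R2 -> R, (forall u v, Rabs (c u - c v) <= dist2 u v) ->
  exists l, Un_cv (fun n => c (p n)) l).
{ intros c Hcl; destruct (R_complete (fun n => c (p n))) as [l Hl]; [|exists l; exact Hl].
  intros e He; destruct (inv_succ_lt e He) as [N HN]; exists N.
  assert (W : forall m n, (N <= m)%nat -> (m <= n)%nat -> Rdist (c (p m)) (c (p n)) < e).
  { intros m n Hm Hmn; unfold Rdist.
    pose proof (Hcl (p m) (p n)); pose proof (H m n Hmn); pose proof (inv_succ_le N m Hm); lra. }
  intros m n Hm Hn; destruct (Nat.le_gt_cases m n); [apply W; lia|].
  rewrite Rdist_sym; apply W; lia. }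
destruct (Hc fst (fun u v => proj1 (coord_le_dist2 u v))) as [a Ha].
destruct (Hc snd (fun u v => proj2 (coord_le_dist2 u v))) as [b Hb].
exists (a, b); intros e He.
destruct (Ha (e / 2) ltac:(lra)) as [N1 H1]; destruct (Hb (e / 2) ltac:(lra)) as [N2 H2].
exists (Nat.max N1 N2); intros n Hn.
eapply Rle_lt_trans; [apply dist2_le_coord|]; cbn [fst snd].
specialize (H1 n ltac:(lia)); specialize (H2 n ltac:(lia)); unfold Rdist in *.
rewrite Rabs_minus_sym in H1; rewrite Rabs_minus_sym in H2; lra.
Qed.

(** The node sequences spell out a branch [y]. Points of the piece at level [n] lie in the closed
    set [C (pre y n)] and come arbitrarily near the limit, which therefore lies in it too. *)
Lemma nested_limit C (d : nat -> node) :
  (forall s, closed_set (C s)) -> fst (d O) = [] ->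
  (forall n, subset (snd (d n)) (branches C (fst (d n)))) ->
  (forall n, exists p, snd (d n) p) ->
  (forall n, refines (/ (INR n + 1)) (d n) (d (S n))) ->
  exists x, suslin C x /\ forall n e, 0 < e -> exists p, snd (d n) p /\ dist2 x p < e.
Proof.
intros HC H0 Hb Hne Hr.
assert (Hsub : forall m n, (m <= n)%nat -> subset (snd (d n)) (snd (d m))).
{ intros m n Hmn; induction Hmn as [|n Hmn IH]; [intros x Hx; exact Hx|].
  intros x Hx; apply IH; apply (proj1 (proj2 (Hr n))), Hx. }
apply choice in Hne; destruct Hne as [p Hp].
(* The shift by one is due to [refines]: the bound for [n] concerns the piece at level [S n]. *)
destruct (R2_limit (fun n => p (S n))) as [x Hx].
{ intros m n Hmn; left; apply (proj2 (proj2 (Hr m))); [apply Hp|].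
  apply (Hsub (S m) (S n)); [lia|apply Hp]. }
assert (Hlim : forall n e, 0 < e -> exists q, snd (d n) q /\ dist2 x q < e).
{ intros n e He; destruct (Hx e He) as [N HN]; exists (p (S (Nat.max N n))); split.
  - apply (Hsub n (S (Nat.max N n))); [lia|apply Hp].
  - apply HN; lia. }
exists x; split; [|exact Hlim].
assert (Ha : forall n, exists a, fst (d (S n)) = fst (d n) ++ [a]) by (intro n; apply Hr).
apply choice in Ha; destruct Ha as [y Hy].
assert (Hpre : forall n, fst (d n) = pre y n).
{ induction n as [|n IH]; [exact H0|rewrite Hy, IH, pre_succ; reflexivity]. }
exists y; intro n; apply NNPP; intro Hn.
destruct (HC _ x Hn) as (e & He & Hball).
destruct (Hlim n e He) as (q & Hq & Hxq); apply (Hball q Hxq).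
destruct (Hb n q Hq) as (y' & Hy' & HCq).
rewrite Hpre, pre_length in Hy'; rewrite <- Hy'; apply HCq.
Qed.

Lemma cantor_family I A :
  sigma_ideal I -> contains_singletons I -> (forall c, I (unit_circle c)) ->
  analytic A -> ~ I A ->
  exists f : (nat -> bool) -> R2, (forall z, A (f z)) /\
    forall z1 z2 z3, distinct3 z1 z2 z3 -> circ (f z1) (f z2) (f z3) <> 0.
Proof.
intros HI Hs Hc (C & HC & HA) HnA.
destruct (dependent_choice (nat -> node)
  (fun n d => (forall i, (i < 2 ^ n)%nat -> positive_node I C (d i)) /\
     (n = O -> fst (d O) = []))
  (fun n d d' => separated (2 ^ S n) d' /\ forall i, (i < 2 ^ S n)%nat ->
     refines (/ (INR n + 1)) (d (Nat.div2 i)) (d' i))) as [d Hd].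
- exists (fun _ => ([], A)); split; [|reflexivity]; intros _ _; split; [exact HnA|].
  intros x Hx; apply HA in Hx; destruct Hx as [y Hy]; exists y; split; [reflexivity|exact Hy].
- intros n d [Hd _].
  destruct (fusion_step I C (fun i => d (Nat.div2 i)) (2 ^ S n) (/ (INR n + 1)) HI Hs Hc
    (inv_succ_pos n)) as (d' & Hsep & Hd').
  { intros i Hi; apply Hd; rewrite Nat.div2_div.
    apply Nat.Div0.div_lt_upper_bound; rewrite Nat.pow_succ_r' in Hi; lia. }
  exists d'; split; [split; [|discriminate]|split; [exact Hsep|]]; intros i Hi; apply Hd', Hi.
- assert (Hz : forall z, exists x, suslin C x /\ forall n e, 0 < e ->
    exists p, snd (d n (branch_index z n)) p /\ dist2 x p < e).
  { intro z; apply (nested_limit C (fun n => d n (branch_index z n))); auto.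
    - apply (Hd O); reflexivity.
    - intro n; apply (proj1 (proj1 (Hd n)) _ (branch_index_lt z n)).
    - intro n; apply NNPP; intro h.
      apply (proj1 (proj1 (proj1 (Hd n)) _ (branch_index_lt z n))).
      apply (sigma_ideal_sub I _ (fun _ => False)); [exact HI| |apply HI].
      intros x Hx; apply h; eauto.
    - intro n; rewrite <- (branch_index_div2 z n).
      apply (proj2 (proj2 (Hd n))), branch_index_lt. }
  apply choice in Hz; destruct Hz as [f Hf].
  exists f; split; [intro z; apply HA, Hf|].
  intros z1 z2 z3 (H12 & H23 & H13).
  destruct (branch_index_neq _ _ H12) as [N1 HN1].
  destruct (branch_index_neq _ _ H23) as [N2 HN2].
  destruct (branch_index_neq _ _ H13) as [N3 HN3].
  (* From this level on the three branches pass through different nodes, whose separation margin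
     covers the limit points. *)
  set (n := Nat.max N1 (Nat.max N2 N3)).
  destruct (proj1 (proj2 (Hd n))) as (e & He & Hsep).
  destruct (proj2 (Hf z1) (S n) e He) as (p1 & Hp1 & Hd1).
  destruct (proj2 (Hf z2) (S n) e He) as (p2 & Hp2 & Hd2).
  destruct (proj2 (Hf z3) (S n) e He) as (p3 & Hp3 & Hd3).
  apply (Hsep _ _ _ (branch_index_lt z1 _) (branch_index_lt z2 _) (branch_index_lt z3 _))
    with (p' := p1) (q' := p2) (r' := p3); auto.
  split; [apply HN1; lia|split; [apply HN2; lia|apply HN3; lia]].
Qed.

(** * Transfinite recursion *)

Definition inj {X Y : Type} (f : X -> Y) : Prop := forall x x', f x = f x' -> x = x'.

Definition interleave (a b : nat -> bool) : nat -> bool :=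
  fun n => if Nat.even n then a (Nat.div2 n) else b (Nat.div2 n).

Lemma interleave_inj a b a' b' : interleave a b = interleave a' b' -> a = a' /\ b = b'.
Proof.
intro H; split; apply functional_extensionality; intro n.
- assert (E := f_equal (fun f => f (2 * n)%nat) H); unfold interleave in E.
  rewrite Nat.even_even, Nat.div2_double in E; exact E.
- assert (E := f_equal (fun f => f (S (2 * n))) H); unfold interleave in E.
  rewrite Nat.even_succ, Nat.odd_even, Nat.div2_succ_double in E; exact E.
Qed.

(* The square of the Cantor set splits into two sets on which [h] is injective;
   either one of them contains a row or the other one meets every row. *)
Lemma inj_of_at_most_two_to_one (X : Type) (h : (nat -> bool) -> X) :
  (forall z1 z2 z3, distinct3 z1 z2 z3 -> h z1 = h z2 -> h z2 = h z3 -> False) ->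
  exists k : (nat -> bool) -> (nat -> bool), inj (fun z => h (k z)).
Proof.
intro H; destruct (WellOrder.exists_well_order (nat -> bool)) as (lt & Hwf & Htot).
(* [A] collects the least point of each fibre of [h]; a fibre has at most one further point. *)
pose (A := fun z => forall z', h z' = h z -> ~ lt z' z).
assert (asym : forall x y, lt x y -> lt y x -> False).
{ intro x; induction x as [x IH] using (well_founded_ind Hwf); intros y h1 h2.
  exact (IH y h2 x h2 h1). }
destruct (classic (exists a, forall b, A (interleave a b))) as [[a Ha]|Hn].
- exists (interleave a); intros b b' E.
  destruct (Htot (interleave a b) (interleave a b')) as [h1|[h1|h1]].
  + destruct (Ha b' _ E h1).
  + apply interleave_inj in h1; tauto.
  + destruct (Ha b _ (eq_sym E) h1).
- assert (Hb : forall a, exists b, ~ A (interleave a b)).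
  { intro a; apply not_all_ex_not; intro hn; apply Hn; exists a; exact hn. }
  apply choice in Hb; destruct Hb as [b Hb].
  exists (fun a => interleave a (b a)); intros x y E.
  assert (Hl : forall a, exists z, h z = h (interleave a (b a)) /\ lt z (interleave a (b a))).
  { intro a; apply NNPP; intro hh; apply (Hb a); intros z Hz Hlt; apply hh; eauto. }
  apply NNPP; intro Hxy.
  assert (Hne : interleave x (b x) <> interleave y (b y)).
  { intro h1; apply interleave_inj in h1; tauto. }
  assert (irr : forall u, ~ lt u u) by (intros u hu; exact (asym u u hu hu)).
  destruct (Hl x) as (zx & Ex & Lx); destruct (Hl y) as (zy & Ey & Ly).
  (* The smaller of the two points has a still smaller one in its fibre, which makes three. *)
  destruct (Htot (interleave x (b x)) (interleave y (b y))) as [h1|[h1|h1]]; [|tauto|].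
  + apply (H zx (interleave x (b x)) (interleave y (b y))); [|congruence|congruence].
    repeat split; try assumption; intro e; subst zx; [exact (irr _ Lx)|exact (asym _ _ h1 Lx)].
  + apply (H zy (interleave y (b y)) (interleave x (b x))); [|congruence|congruence].
    repeat split; try congruence; intro e; subst zy; [exact (irr _ Ly)|exact (asym _ _ h1 Ly)].
Qed.

(* [j] embeds [T] into the least initial segment of a well-order that has room for it. *)
Lemma short_well_order (T : Type) : exists (lt : T -> T -> Prop) (j : T -> T),
  well_founded lt /\ (forall x y, lt x y \/ x = y \/ lt y x) /\ inj j /\
  forall t (g : T -> T), inj g -> exists u, ~ lt (g u) (j t).
Proof.
destruct (WellOrder.exists_well_order T) as (lt & Hwf & Htot); exists lt.
pose (Room := fun a => exists g : T -> T, inj g /\ forall u, lt (g u) a).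
destruct (classic (exists a, Room a)) as [[a Ha]|Hn].
- induction a as [a IH] using (well_founded_ind Hwf).
  destruct (classic (exists b, lt b a /\ Room b)) as [(b & Hb & Rb)|Hm]; [exact (IH b Hb Rb)|].
  destruct Ha as (j & Hj & Hja); exists j.
  split; [exact Hwf|split; [exact Htot|split; [exact Hj|]]].
  intros t g Hg; apply not_all_ex_not; intro h.
  apply Hm; exists (j t); split; [apply Hja|exists g; auto].
(* No proper initial segment has room for [T], so the identity serves. *)
- exists (fun t => t); split; [exact Hwf|split; [exact Htot|split; [intros x y E; exact E|]]].
  intros t g Hg; apply not_all_ex_not; intro h; apply Hn; exists t, g; auto.
Qed.

(** The constraint at [s] depends only on the values below [s], so the recursion may fill in [x0]
    elsewhere. *)
Lemma well_founded_choice (T X : Type) (lt : T -> T -> Prop) (x0 : X)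
  (Phi : T -> (T -> X) -> X -> Prop) : well_founded lt ->
  (forall s x x' p, (forall u, lt u s -> x u = x' u) -> Phi s x p -> Phi s x' p) ->
  (forall s x, exists p, Phi s x p) -> exists x, forall s, Phi s x (x s).
Proof.
intros Hwf Hext Hex.
assert (Hc : forall sx : T * (T -> X), exists p, Phi (fst sx) (snd sx) p)
  by (intros [s x]; apply Hex).
apply choice in Hc; destruct Hc as [c Hc].
pose (F := fun (s : T) (rec : forall u, lt u s -> X) => c (s, fun u =>
  match excluded_middle_informative (lt u s) with left h => rec u h | right _ => x0 end)).
exists (Fix Hwf (fun _ => X) F); intro s; rewrite Fix_eq.
- unfold F at 2; eapply Hext; [|apply (Hc (s, _))]; intros u Hu; cbn.
  destruct (excluded_middle_informative (lt u s)); [reflexivity|contradiction].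
- intros t f g E; unfold F; f_equal; f_equal.
  apply functional_extensionality; intro u.
  destruct (excluded_middle_informative (lt u t)); auto.
Qed.

(** * Closure properties of Borel sets *)

Lemma borel_compl A : borel A -> borel (fun x => ~ A x).
Proof. intros HA S HS HU; apply HS, HA; assumption. Qed.

Lemma borel_ext (A B : pset) : (forall x, A x <-> B x) -> borel A -> borel B.
Proof.
intros H HA; replace B with A; [exact HA|].
apply functional_extensionality; intro x.
apply propositional_extensionality, H.
Qed.

Lemma borel_diff A B : borel A -> borel B -> borel (fun x => A x /\ ~ B x).
Proof.
intros HA HB.
apply (borel_ext (fun x => ~ exists n : nat, (match n with O => fun y => ~ A y | _ => B end) x)).
- intro x; split.
  + intro H; split; [apply NNPP; intro h; apply H; exists O; exact h|].
    intro h; apply H; exists 1%nat; exact h.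
  + intros [h1 h2] [[|n] h]; [exact (h h1)|exact (h2 h)].
- apply borel_compl; intros S HS HU; apply HS; intros [|n].
  + apply borel_compl; assumption.
  + apply HB; assumption.
Qed.

Lemma borel_translate A v : borel A -> borel (translate A v).
Proof.
intros HA S HS HU; apply (HA (fun B => S (translate B v))).
- split.
  + intros B HB; apply (proj1 HS (translate B v) HB).
  + intros F HF; apply (proj2 HS (fun n => translate (F n) v) HF).
- intros U Uo; apply HU; intros x Hx; destruct (Uo _ Hx) as (e & He & H).
  exists e; split; [exact He|]; intros y Hy; apply H; cbn [fst snd].
  replace (dist2 _ _) with (dist2 x y); [exact Hy|].
  unfold dist2; cbn [fst snd]; f_equal; ring.
Qed.

Lemma unit_distance_free_hitting I :
  sigma_ideal I -> contains_singletons I -> (forall c, I (unit_circle c)) ->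
  exists B : pset, (forall x y, B x -> B y -> dist2 x y <> 1) /\
    forall A, borel A -> ~ I A -> exists x, A x /\ B x.
Proof.
intros HI Hs Hc.
destruct (short_well_order (nat -> bool)) as (lt & j & Hwf & Htot & Hj & Hshort).
destruct (well_founded_choice (nat -> bool) R2 lt (0, 0)
  (fun s x p => forall t, j t = s -> ~ I (decode t) ->
     decode t p /\ forall u, lt u s -> dist2 p (x u) <> 1) Hwf) as [x Hx].
- intros s x x' p E H t Ht Hn; destruct (H t Ht Hn) as [H1 H2]; split; [exact H1|].
  intros u Hu; rewrite <- (E u Hu); auto.
- intros s x; destruct (classic (exists t, j t = s /\ ~ I (decode t))) as [(t & Ht & Hn)|Hno].
  2: { exists (0, 0); intros t Ht Hn; destruct Hno; eauto. }
  (* Otherwise every [f z] is at distance 1 from some earlier [x (h z)]. By [Hcirc] the map [h] is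
     at most two-to-one, so 2^N would embed below [j t]. *)
  apply NNPP; intro Hp.
  destruct (cantor_family I (decode t) HI Hs Hc (decode_analytic t) Hn) as (f & Hf & Hcirc).
  assert (Hu : forall z, exists u, lt u s /\ dist2 (f z) (x u) = 1).
  { intro z; apply NNPP; intro h; apply Hp; exists (f z); intros t' Ht' Hn'.
    rewrite <- Ht in Ht'; apply Hj in Ht'; subst t'; split; [apply Hf|].
    intros u Hu E; apply h; eauto. }
  apply choice in Hu; destruct Hu as [h Hh].
  destruct (inj_of_at_most_two_to_one _ h) as [k Hk].
  { intros z1 z2 z3 Hd E12 E23; apply (Hcirc z1 z2 z3 Hd).
    apply (circ_unit_circle (x (h z1))); unfold unit_circle; [|rewrite E12|rewrite E12, E23];
      apply Hh. }
  destruct (Hshort t _ Hk) as [u Hu]; apply Hu; rewrite Ht; apply Hh.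
(* Other stages are unconstrained and may hold any value, so their points are left out. *)
- exists (fun p => exists t, ~ I (decode t) /\ p = x (j t)); split.
  + intros p q (t & Ht & ->) (t' & Ht' & ->).
    destruct (Htot (j t) (j t')) as [h|[h|h]].
    * rewrite dist2_sym; apply (Hx (j t') t' eq_refl Ht'), h.
    * rewrite h, dist2_refl; lra.
    * apply (Hx (j t) t eq_refl Ht), h.
  + intros A HA HnA; destruct (analytic_decode A (borel_analytic A HA)) as [t Ht].
    assert (Hn : ~ I (decode t)).
    { intro h; apply HnA; apply (sigma_ideal_sub I _ _ HI) with (2 := h); intro y; apply Ht. }
    exists (x (j t)); split; [apply Ht, (Hx (j t) t eq_refl Hn)|exists t; auto].
Qed.

(** If the trace were in [I], a Borel set [D] in [I] would contain it, and [A] minus [D] would be a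
    positive Borel set missing [B]. *)
Lemma hitting_not_in_ideal I A B : sigma_ideal I -> borel_base I ->
  (forall A, borel A -> ~ I A -> exists x, A x /\ B x) ->
  borel A -> ~ I A -> ~ I (fun x => A x /\ B x).
Proof.
intros HI Hb Hhit HA HnA HAB; destruct (Hb _ HAB) as (D & HD & ID & Hsub).
destruct (Hhit (fun x => A x /\ ~ D x)) as (x & [Hx HxD] & HxB).
- apply borel_diff; assumption.
- intro h; apply HnA; apply (sigma_ideal_sub I _ (fun x => (A x /\ ~ D x) \/ D x) HI).
  + intros x Hx; destruct (classic (D x)); auto.
  + apply sigma_ideal_union2; assumption.
- apply HxD, Hsub; auto.
Qed.

Theorem mainTheorem18 (I : pset -> Prop) :
  sigma_ideal I -> proper_ideal I -> translation_invariant I ->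
  contains_singletons I -> borel_base I ->
  (forall c, I (unit_circle c)) ->
  exists B : pset, completely_nonmeasurable I B /\ ~ two_I_covering B.
Proof.
intros HI _ Htr Hs Hb Hc.
destruct (unit_distance_free_hitting I HI Hs Hc) as (B & Hfree & Hhit).
assert (Hunit : dist2 (1, 0) (0, 0) = 1)
  by (apply dist2_eq1; unfold sqdist; cbn [fst snd]; ring).
exists B; split.
- intros A HA HnA; split; [apply hitting_not_in_ideal; assumption|].
  apply hitting_not_in_ideal; try assumption; clear A HA HnA; intros A HA HnA.
  (* If [A] were contained in [B], then [B] and its unit translate would meet. *)
  destruct (Hhit (translate A (1, 0))) as (y & Hy & HyB).
  + apply borel_translate, HA.
  + intro h; apply HnA; apply (sigma_ideal_sub I _ _ HI) with (2 := Htr _ (-1, 0) h).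
    intros [a b] Hab; unfold translate; cbn [fst snd].
    replace (a - -1 - 1) with a by ring; replace (b - 0 - 0) with b by ring; exact Hab.
  + exists (fst y - 1, snd y - 0); split; [exact Hy|]; intro h; apply (Hfree _ _ HyB h).
    apply dist2_eq1; unfold sqdist; cbn [fst snd]; ring.
- intro Hcov.
  (* A pair at distance 1 has no isometric copy in [B]. *)
  destruct (Hcov (fun x => x = (1, 0) \/ x = (0, 0))) as (phi & [Hphi _] & HB).
  + exists (1, 0), (0, 0); split; [intro e; injection e; lra|tauto].
  + apply (Hfree (phi (1, 0)) (phi (0, 0))); [apply HB; auto|apply HB; auto|].
    rewrite Hphi; exact Hunit.
Qed.
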